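(* Let $n\ge 3$. The first $n-1$ tensor powers $S_{(n-1,1)}^{\otimes k}$, $1\le k\le n-1$, of $S_{(n-1,1)}$ are an integral basis for the vector space spanned by the positive tensor powers. The $n$th tensor power of $S_{(n-1,1)}$ is an integer linear combination of the first $n-1$ tensor powers: $$S_{(n-1,1)}^{\otimes n}=\bigoplus_{k=1}^{n-1}a_k(n)\,S_{(n-1,1)}^{\otimes k},$$ with $a_{n-1}(n)=\binom{n-1}{2}$. The coefficients $a_k(n)$ are determined by the polynomial $P(t)=t^n-\sum_{k=1}^{n-1}a_k(n)t^k$, defined by $$P(t)=\frac{t+1}{t-(n-2)}\sum_{j=1}^{n}c(n,j)\,t^j(-1)^{n-j},$$ where $c(n,j)$ is the number of permutations in $S_n$ with exactly $j$ disjoint cycles.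
   Context: $S_{(n-1,1)}$ is the irreducible complex $S_n$-module indexed by $(n-1,1)$. The identities are in the representation ring (equivalently, between characters), the coefficients $a_k(n)$ being possibly negative integers. The vector space in question is the space of class functions on $S_n$ spanned by the characters of $S_{(n-1,1)}^{\otimes k}$, $k\ge 1$; ''integral basis'' means that these characters form a basis in which every positive tensor power has integer coordinates. *)

(* Defs.v *)
From mathcomp Require Import all_boot all_order all_algebra.
From mathcomp Require Import all_fingroup all_solvable all_field all_character.

Set Implicit Arguments.
Unset Strict Implicit.
Unset Printing Implicit Defensive.

Import GRing.Theory.
Local Open Scope ring_scope.

(* Complex representations are taken over algC, the field of complex algebraic
   numbers, over which MathComp develops the characters of finite groups. *)

Section Specht.
Variables (n : nat) (lam : seq nat).

(* lam is meant to be a partition of n, given as the sequence of its parts.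
   The Young diagram of lam is numbered 0, ..., n.-1 in reading order, so that
   entry i lies in row reshape_index lam i and column reshape_offset lam i. *)
Definition row_stab : {set 'S_n} :=
  [set p : 'S_n | [forall i, reshape_index lam (p i) == reshape_index lam i]].

Definition col_stab : {set 'S_n} :=
  [set q : 'S_n | [forall i, reshape_offset lam (q i) == reshape_offset lam i]].

(* The element \sum_p \sum_q (-1)^q p q of the group algebra of 'S_n, in
   coordinates on the basis of group elements. *)
Definition young_symmetrizer : 'rV[algC]_#|[set: 'S_n]| :=
  \sum_(p in row_stab) \sum_(q in col_stab)
     (-1) ^+ q *: delta_mx 0 (gring_index [set: 'S_n]%G (p * q)%g).

(* MathComp groups act on row vectors on the right, the regular representation
   being right multiplication: the irreducible module indexed by lam is the
   right ideal generated by the Young symmetrizer. *)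
Definition specht : representation algC [set: 'S_n] :=
  Representation (submod_repr
    (cyclic_mx_module (regular_repr algC [set: 'S_n]) young_symmetrizer)).

End Specht.

Section TensorPower.
Variables (gT : finGroupType) (G : {group gT}).

Lemma triv_mx_repr : mx_repr G (fun _ : gT => 1%:M : 'M[algC]_1).
Proof. by split=> // x y _ _; rewrite mulmx1. Qed.

Definition triv_grepr : representation algC G :=
  Representation (MxRepresentation triv_mx_repr).

Fixpoint tensor_power (rG : representation algC G) (k : nat) :
    representation algC G :=
  if k is k'.+1 then Representation (prod_repr rG (tensor_power rG k'))
  else triv_grepr.

End TensorPower.

Definition std_tensor_char (n k : nat) : 'CF([set: 'S_n]) :=
  cfRepr (tensor_power (specht n [:: n.-1; 1%N]) k).

Definition is_positive_span (K : fieldType) (vT : vectType K)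
    (F : nat -> vT) (V : {vspace vT}) : Prop :=
  forall v : vT,
    v \in V <-> exists (m : nat) (c : nat -> K),
                  v = \sum_(1 <= k < m.+1) c k *: F k.

Definition is_integral_basis (K : fieldType) (vT : vectType K)
    (F : nat -> vT) (d : nat) (V : {vspace vT}) : Prop :=
  basis_of V [seq F k | k <- iota 1 d] /\
  forall k : nat, (0 < k)%N ->
    exists z : nat -> int, F k = \sum_(1 <= j < d.+1) F j *~ z j.

Definition cycle_count (n j : nat) : nat :=
  #|[set s : 'S_n | #|porbits s| == j]|.

(* Main.v *)
Require Import Defs.
From mathcomp Require Import all_boot all_order all_algebra.
From mathcomp Require Import all_fingroup all_solvable all_field all_character.

Set Implicit Arguments.
Unset Strict Implicit.
Unset Printing Implicit Defensive.

Import GRing.Theory.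
Local Open Scope ring_scope.

(* The Specht module of (n-1,1) is the image, inside the regular module, of the
   sum-zero part of the permutation module, so its character is
   chi(s) = #fix(s) - 1. As s ranges over S_n, #fix(s) takes exactly the values
   0, ..., n-2 and n, so chi takes n distinct integer values, one of them 0.
   A polynomial in chi vanishes iff it vanishes at these n values: hence chi,
   ..., chi^(n-1) are free, every power reduces modulo the monic integer
   polynomial Q with these roots, and the relation of degree n is Q itself.
   Finally (t - (n-2)) Q(t) = (t + 1) t (t-1) ... (t-(n-1)), and the falling
   factorial is the signed generating function of S_n by number of cycles. *)

(** * The character of the Specht module of (n-1,1) *)

(* U is presented by the redundant spanning set [E *m phi], with E a projection
   in the intended use, which avoids choosing a basis of U. *)
Lemma mxtrace_submod_factor (F : fieldType) (gT : finGroupType) (G : {group gT})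
    (N n : nat) (rG : mx_representation F G N) (U : 'M[F]_N)
    (modU : mxmodule rG U) (E : 'M[F]_n) (phi : 'M[F]_(n, N))
    (P : 'M[F]_n) (x : gT) :
    row_free phi -> (U :=: E *m phi)%MS -> x \in G ->
    phi *m rG x = P *m phi -> E *m P *m E = E *m P ->
  \tr (submod_repr modU x) = \tr (E *m P).
Proof.
move=> free_phi defU Gx phiJ EPE.
set S := submod_repr modU x; pose C := row_base U.
have CJ : C *m rG x = S *m C.
  have := val_submodJ modU 1%:M Gx.
  by rewrite mul1mx /val_submod /= mul1mx => <-.
(* [A] and [B] pass between the row basis [C] of [U] and the spanning rows [E *m phi]: [A *m B] is
   the identity and [B *m A] fixes [E]. Hence [S] is [A *m (E *m P *m B)], and cyclicity of the
   trace removes [A] and [B]. *)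
have /submxP[A defC] : (C <= E *m phi)%MS.
  by rewrite -defU eq_row_base.
have /submxP[B defE] : (E *m phi <= C)%MS.
  by rewrite eq_row_base defU.
have AB1 : A *m B = 1%:M.
  apply: (row_free_inj (row_base_free U)).
  by rewrite -/C -mulmxA -defE -defC mul1mx.
have BAE : B *m A *m E = E.
  by apply: (row_free_inj free_phi); rewrite -!mulmxA -defC defE.
have BS : B *m S = E *m P *m B.
  apply: (row_free_inj (row_base_free U)); rewrite -/C.
  rewrite -mulmxA -CJ mulmxA -defE -mulmxA phiJ mulmxA -EPE.
  by rewrite -mulmxA defE mulmxA EPE.
have -> : S = A *m (E *m P *m B) by rewrite -BS mulmxA AB1 mul1mx.
by rewrite mxtrace_mulC -(mulmxA (E *m P)) [LHS]mxtrace_mulC mulmxA BAE.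
Qed.

Section SpechtCharacter.

Variable m : nat.
Local Notation n := m.+2.
Local Notation G := [set: 'S_n]%G.
Local Notation aG := (regular_repr algC G).
Local Notation d :=
  (fun x : 'S_n => delta_mx 0 (gring_index G x) : 'rV[algC]_#|G|).

(* Row i is the sum of the right coset of the stabilizer of ord_max formed by
   the permutations sending ord_max to i. *)
Definition coset_mx : 'M[algC]_(n, #|G|) :=
  \matrix_i \sum_(x : 'S_n | x ord_max == i) d x.

Lemma delta_regular (x g : 'S_n) : d x *m aG g = d (x * g)%g.
Proof. by rewrite -rowE rowK gring_indexK ?inE. Qed.

Lemma row_coset_mxJ i (g : 'S_n) :
  row i coset_mx *m aG g = row (g i) coset_mx.
Proof.
rewrite !rowK mulmx_suml [RHS](reindex_inj (mulIg g)) /=.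
by apply: eq_big => x; rewrite ?delta_regular // permM (inj_eq perm_inj).
Qed.

(** Together with [coset_mx_free], this embeds the natural permutation module into the regular
    module. *)
Lemma coset_mxJ (g : 'S_n) : coset_mx *m aG g = perm_mx g *m coset_mx.
Proof.
apply/row_matrixP=> i; rewrite row_mul row_coset_mxJ -row_permE.
by apply/rowP=> j; rewrite !mxE.
Qed.

(** The coset sums have disjoint supports; the right inverse reads off the coefficient of one
    representative per coset, [tperm ord_max j]. *)
Lemma coset_mx_free : row_free coset_mx.
Proof.
apply/row_freeP.
exists (\matrix_(k, j) (enum_val k == tperm ord_max j)%:R).
apply/row_matrixP=> i; rewrite row_mul rowK mulmx_suml row1.
apply/rowP=> j; rewrite summxE mxE /=.
under eq_bigr do rewrite -rowE !mxE gring_indexK ?inE //.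
case: (eqVneq j i) => [->|ne_ij].
  rewrite (bigD1 (tperm ord_max i)) /= ?tpermL // eqxx big1 ?addr0 //.
  by move=> x /andP[_ /negPf->].
rewrite big1 // => x /eqP xi; case: eqP => // xE.
by case/eqP: ne_ij; rewrite -xi xE tpermL.
Qed.

(** In reading order 0, ..., n-2 fill the first row, and [ord_max] is alone in the second, below
    [ord0]. *)
Lemma reshape_index_hook (i : 'I_n) :
  reshape_index [:: m.+1; 1%N] i = (i == ord_max).
Proof.
rewrite /reshape_index /= subSS subn_eq0 -val_eqE /=.
have := leq_ord i; rewrite leq_eqVlt ltnS => /orP[/eqP-> | le_im].
  by rewrite eqxx ltnn subSnn subnn.
by rewrite le_im ltn_eqF.
Qed.

Lemma reshape_offset_hook (i : 'I_n) :
  reshape_offset [:: m.+1; 1%N] i = if i == ord_max then 0%N else i.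
Proof.
rewrite /reshape_offset reshape_index_hook.
by case: eqP => [->|_] /=; rewrite ?addn0 ?subnn ?subn0.
Qed.

Lemma row_stab_hook :
  row_stab n [:: n.-1; 1%N] = [set p : 'S_n | p ord_max == ord_max].
Proof.
apply/setP=> p; rewrite !inE; apply/forallP/eqP => [/(_ ord_max) | pmax i].
  by rewrite !reshape_index_hook eqxx eqb1 => /eqP.
by rewrite !reshape_index_hook -{1}pmax (inj_eq perm_inj).
Qed.

(** Only [ord0] and [ord_max] share a column, so nothing but their exchange is possible. *)
Lemma col_stab_hook :
  col_stab n [:: n.-1; 1%N] = [set 1%g; tperm ord0 ord_max].
Proof.
apply/setP=> q; rewrite !inE; apply/forallP/orP => [qP | [] /eqP-> i]; first last.
- rewrite !reshape_offset_hook.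
  by case: tpermP => [->|->|//]; rewrite ?eqxx.
- by rewrite perm1.
have offset0 (j : 'I_n) :
    reshape_offset [:: m.+1; 1%N] j == 0%N -> j = ord0 \/ j = ord_max.
  rewrite reshape_offset_hook.
  by case: ifP => [/eqP|_ /eqP j0]; [right | left; apply: val_inj].
have q0 : q ord0 = ord0 \/ q ord0 = ord_max.
  by apply/offset0; rewrite (eqP (qP ord0)) reshape_offset_hook.
have qmax : q ord_max = ord0 \/ q ord_max = ord_max.
  by apply/offset0; rewrite (eqP (qP ord_max)) reshape_offset_hook eqxx.
have fix_q i : i != ord0 -> i != ord_max -> q i = i.
  move=> i0 imax; have := qP i; rewrite !reshape_offset_hook (negPf imax).
  case: ifP => [_ /eqP/esym i_0 | _ /eqP]; last exact: val_inj.
  by case/eqP: i0; apply: val_inj.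
have q0max : q ord0 <> q ord_max by move/perm_inj.
case: q0 => q0; [left | right]; apply/eqP/permP=> i.
  rewrite perm1; case: (eqVneq i ord0) => [-> // | i0].
  case: (eqVneq i ord_max) => [-> | imax]; last exact: fix_q.
  by case: qmax => // qm; case: q0max; rewrite q0 qm.
case: tpermP => [-> // | -> | /eqP i0 /eqP imax]; last exact: fix_q.
by case: qmax => // qm; case: q0max; rewrite q0 qm.
Qed.

(** Right multiplication by the odd transposition carries the permutations fixing [ord_max] to those
    sending [ord_max] to [ord0]. *)
Lemma young_symmetrizer_hook :
  young_symmetrizer n [:: n.-1; 1%N] = row ord_max coset_mx - row ord0 coset_mx.
Proof.
rewrite /young_symmetrizer row_stab_hook col_stab_hook.
have ne_t : 1%g != tperm ord0 ord_max :> 'S_n.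
  by apply/eqP=> /permP/(_ ord0); rewrite perm1 tpermL.
under eq_bigr do rewrite big_setU1 ?inE //= big_set1 odd_perm1 odd_tperm /=
  mulg1 expr0 expr1 scale1r scaleN1r.
rewrite sumrB !rowK; congr (_ - _); first by apply: eq_bigl => x; rewrite inE.
rewrite [RHS](reindex_inj (mulIg (tperm ord0 ord_max))) /=.
apply: eq_bigl => x; rewrite inE permM.
by rewrite (can2_eq (tpermK _ _) (tpermK _ _)) tpermL.
Qed.

Lemma mxtrace_perm (g : 'S_n) :
  \tr (perm_mx g : 'M[algC]_n) = #|[set i | g i == i]|%:R.
Proof.
rewrite /mxtrace -sum1_card natr_sum big_mkcond /= [RHS]big_mkcond /=.
by apply: eq_bigr => i _; rewrite !mxE inE eq_sym; case: eqP.
Qed.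

Lemma cfRepr_specht_hook (g : 'S_n) :
  cfRepr (specht n [:: n.-1; 1%N]) g = #|[set i | g i == i]|%:R - 1.
Proof.
pose c : 'cV[algC]_n := const_mx 1.
pose r : 'rV[algC]_n := delta_mx 0 ord_max.
have rc : r *m c = 1%:M.
  by apply/rowP=> j; rewrite -rowE !mxE (ord1 j).
have Pc h : perm_mx h *m c = c.
  by rewrite -row_permE; apply/colP=> j; rewrite !mxE.
(* On row vectors [E] is the projection onto the sum-zero vectors along [r]. *)
pose E : 'M[algC]_n := 1%:M - c *m r.
have Ec : E *m c = 0.
  by rewrite mulmxBl mul1mx -mulmxA rc mulmx1 subrr.
have rowE i : row i (E *m coset_mx) = row i coset_mx - row ord_max coset_mx.
  rewrite mulmxBl mul1mx -mulmxA linearB /= row_mul.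
  rewrite -[r *m coset_mx]rowE; congr (_ - _).
  have -> : row i c = 1%:M by apply/rowP=> j; rewrite !mxE (ord1 j).
  by rewrite mul1mx.
rewrite cfunE inE mulr1n.
rewrite (mxtrace_submod_factor _ coset_mx_free _ _ (coset_mxJ g) (E := E))
  ?inE //.
- rewrite mulmxBl mul1mx linearB /= mxtrace_perm; congr (_ - _).
  (* Since [perm_mx g] fixes [c], the subtracted term has the trace of [r *m c], which is 1. *)
  rewrite mxtrace_mulC mulmxA Pc mxtrace_mulC rc.
  by rewrite /mxtrace big_ord1 mxE.
- apply/eqmxP/andP; split.
    apply: cyclic_mx_sub.
      apply/mxmoduleP => h _.
      rewrite -mulmxA coset_mxJ mulmxA.
      have -> : E *m perm_mx h = E *m perm_mx h *m E.
        by rewrite mulmxBr mulmx1 mulmxA -(mulmxA E) Pc Ec mul0mx subr0.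
      by rewrite -(mulmxA (E *m perm_mx h)) submxMl.
    rewrite young_symmetrizer_hook -opprB -rowE.
    by rewrite eqmx_opp row_sub.
  apply/row_subP=> i; rewrite rowE.
  case: (eqVneq i ord_max) => [->|ne_i]; first by rewrite subrr sub0mx.
  (* [h] sends [ord_max] to [i] and [ord0] to [ord_max], so it carries the symmetrizer to row [i] of
     [E *m coset_mx]. *)
  pose h : 'S_n := (tperm ord0 ord_max * tperm ord0 i)%g.
  have := mxmodule_trans (cyclic_mx_module aG _) (in_setT h)
    (cyclic_mx_id aG (young_symmetrizer n [:: n.-1; 1%N])).
  rewrite {1}young_symmetrizer_hook mulmxBl !row_coset_mxJ.
  by rewrite !permM tpermL tpermR tpermL tpermD // eq_sym.
- by rewrite mulmxBr mulmx1 mulmxA -(mulmxA E) Pc Ec mul0mx subr0.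
Qed.

End SpechtCharacter.

Lemma std_tensor_charE n k :
  std_tensor_char n k = cfRepr (specht n [:: n.-1; 1%N]) ^+ k.
Proof.
elim: k => [|k IHk]; last by rewrite exprS -IHk /std_tensor_char cfRepr_prod.
apply/cfunP=> g; rewrite expr0 cfun1E cfunE inE mulr1n.
by rewrite /= mxtrace1.
Qed.

(** * Sets of fixed points of permutations *)

Section FixedPoints.

Variable T : finType.
Implicit Types (A : {set T}) (s : {perm T}).

(** A permutation cannot move exactly one point. *)
Lemma card_fixed_neq_pred s : #|[set x | s x == x]| != #|T|.-1 \/ s = 1%g.
Proof.
case: eqP => [eq_fix | _]; last by left.
right; apply: (@perm_on_id _ _ (~: [set x | s x == x])).
  by apply/subsetP=> x; rewrite !inE.
have := cardsC [set x | s x == x]; rewrite eq_fix.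
case: #|T| => [|t] /=; first by rewrite add0n => ->.
by rewrite -addn1 => /addnI->.
Qed.

Lemma perm_with_fixed_set A :
  #|~: A| != 1%N -> exists s : {perm T}, [set x | s x == x] = A.
Proof.
(* The witness is one cycle through the complement of [A], in enumeration order; it moves each of
   these points because its length is not 1. *)
move=> cardAC; pose p := enum (~: A); have Up : uniq p := enum_uniq _.
exists (perm (can_inj (prev_next Up))); apply/setP=> x; rewrite inE permE.
have [Ax | A'x] := boolP (x \in A).
  by rewrite next_nth mem_enum inE Ax eqxx.
have px : x \in p by rewrite mem_enum inE.
have [i q rot_p] := rot_to px.
rewrite -(next_rot i Up) rot_p.
have := rot_uniq i p; rewrite rot_p Up.
case: q => [|y q] in rot_p *.
  move/(congr1 size): rot_p; rewrite size_rot -cardE => /eqP.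
  by rewrite (negPf cardAC).
by rewrite /= !inE eqxx negb_or eq_sym => /andP[/andP[/negPf-> _] _].
Qed.

End FixedPoints.

(** * Permutations counted by number of cycles *)

Lemma perm_on_set1D (T : finType) (A : {set T}) (a : T) (s : {perm T}) :
  perm_on (A :\ a) s = perm_on A s && (s a == a).
Proof.
apply/idP/andP=> [sAa | [sA /eqP sa]].
  rewrite (out_perm sAa) ?setD11 //; split=> //.
  exact: subset_trans sAa (subsetDl _ _).
apply/subsetP=> x sx; rewrite !inE (subsetP sA _ sx) andbT.
by apply: contraNneq sx => ->; rewrite sa.
Qed.

Lemma porbits_tperm_fixed (T : finType) (s : {perm T}) (a j : T) :
  j != a -> s a = a -> #|porbits s| = #|porbits (tperm a j * s)|.+1.
Proof.
move=> ne_ja sa.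
have a_notin : a \notin porbit s j.
  rewrite porbit_sym; apply: contra ne_ja => /porbitP[i ->].
  by elim: i => [|i /eqP IHi]; rewrite ?perm1 // expgSr permM IHi sa.
have := porbits_mul_tperm s a j; rewrite a_notin eq_sym ne_ja /= addn2 addn1.
by case.
Qed.

(* For a in A, a permutation on A is uniquely tperm a j * s with j in A and s
   on A :\ a, and for j != a the transposition merges the cycle (a) into that
   of j. The factor x ^+ #|A| avoids dividing by x. *)
Lemma sum_perm_on_porbits (R : comNzRingType) (x : R) (T : finType)
    (A : {set T}) :
  x ^+ #|A| * \sum_(s | perm_on A s) (-1) ^+ odd_perm s * x ^+ #|porbits s| =
  x ^+ #|T| * \prod_(i < #|A|) (x - i%:R).
Proof.
move cardA: #|A| => k; elim: k A cardA => [|k IHk] A cardA.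
  move/cards0_eq: cardA => ->; rewrite big_ord0 mul1r mulr1.
  rewrite (big_pred1 1%g) => [|s]; last first.
    apply/idP/eqP=> [/perm_on_id-> // | ->]; last exact: perm_on1.
    by rewrite cards0.
  rewrite odd_perm1 mul1r; congr (x ^+ _).
  rewrite card_in_imset ?cardT // => y z _ _ yz.
  have := porbit_id 1%g y; rewrite yz => /porbitP[i ->].
  by rewrite expg1n perm1.
have /card_gt0P[a Aa] : (0 < #|A|)%N by rewrite cardA.
have cardB : #|A :\ a| = k by move: cardA; rewrite (cardsD1 a) Aa => -[].
pose F (s : {perm T}) := (-1) ^+ odd_perm s * x ^+ #|porbits s|.
rewrite (eq_bigr F) //.
(* The sum is split according to the point [j] that [s] sends to [a]; removing [tperm a j] on the
   left leaves a permutation fixing [a]. *)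
rewrite (partition_big (fun s : {perm T} => (s^-1)%g a) [in A]) /=; last first.
  by move=> s /perm_onV/perm_closed->.
have step j : j \in A ->
    \sum_(s | perm_on A s && ((s^-1)%g a == j)) F s =
    \sum_(s | perm_on (A :\ a) s) F (tperm a j * s)%g.
  move=> Aj; rewrite (reindex_inj (mulgI (tperm a j))) /=.
  have tA : perm_on A (tperm a j).
    by apply: subset_trans (tperm_on a j) _; rewrite subUset !sub1set Aa.
  apply: eq_bigl => s; rewrite perm_on_set1D; congr (_ && _).
    apply/idP/idP => [ts | ]; last exact: perm_onM.
    by rewrite -(mulKg (tperm a j) s) tpermV perm_onM.
  rewrite invMg tpermV permM (can2_eq (tpermK _ _) (tpermK _ _)) tpermR.
  by rewrite (can2_eq (permKV s) (permK s)) eq_sym.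
rewrite (eq_bigr _ step) (bigD1 a) //= tperm1.
under eq_bigr do rewrite mul1g.
rewrite big_ord_recr /= mulrA -(IHk _ cardB) (eq_bigr F) //.
rewrite exprSr -!mulrA; congr (_ * _).
rewrite mulrDr mulrBr; congr (_ + _); first by rewrite mulrC.
rewrite [in RHS]mulr_natr -cardB.
(* The transposition flips the sign and loses one cycle, which the factor [x] restores. The term
   [j = a] and the [k] others thus combine into the new factor [x - k%:R]. *)
have stepF j : j != a ->
    x * (\sum_(s | perm_on (A :\ a) s) F (tperm a j * s)%g) =
    - \sum_(s | perm_on (A :\ a) s) F s.
  move=> ne_ja; rewrite mulr_sumr -sumrN; apply: eq_bigr => s.
  rewrite perm_on_set1D => /andP[_ /eqP sa].
  rewrite /F odd_mul_tperm eq_sym ne_ja (porbits_tperm_fixed ne_ja sa) exprS.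
  by rewrite signr_addb expr1 mulrCA mulN1r !mulNr.
rewrite mulr_sumr (eq_bigr _ (fun j jP => stepF j (andP jP).2)).
rewrite sumr_const mulNrn.
congr (- (_ *+ _)); by apply: eq_card => j; rewrite !inE andbC.
Qed.

(** This is the preceding identity for the full set and [x = 'X], where the power of ['X] can be
    cancelled. *)
Lemma sum_cycle_count n :
  (0 < n)%N ->
  \sum_(1 <= j < n.+1) ((cycle_count n j)%:Z * (-1) ^+ (n - j)) *: 'X^j =
  \prod_(i < n) ('X - (i%:Z)%:P) :> {poly int}.
Proof.
move=> n_gt0; have -> : \prod_(i < n) ('X - (i%:Z)%:P) =
    \sum_(s : 'S_n) (-1) ^+ odd_perm s * 'X^#|porbits s| :> {poly int}.
  have := sum_perm_on_porbits ('X : {poly int}) [set: 'I_n].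
  rewrite cardsT card_ord => /(mulfI _).
  rewrite expf_eq0 polyX_eq0 andbF => /(_ isT).
  have onT : perm_on [set: 'I_n] =1 xpredT.
    by move=> s; apply/subsetP=> i; rewrite inE.
  rewrite (eq_bigl _ _ onT) => ->.
  by apply: eq_bigr => i _; rewrite -natz polyC_natr.
have porbits_le (s : 'S_n) : (#|porbits s| <= n)%N.
  by rewrite -[leqRHS]card_ord; apply: leq_imset_card.
transitivity (\sum_(1 <= j < n.+1) \sum_(s : 'S_n | j == #|porbits s|)
    (-1) ^+ odd_perm s * 'X^j : {poly int}).
  apply: eq_big_nat => j /andP[_ le_jn].
  rewrite (eq_bigr (fun=> (-1) ^+ (n - j) * 'X^j)) => [|s /eqP->].
    rewrite sumr_const -natz -scalerA scaler_nat /cycle_count.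
    rewrite -mul_polyC -signr_odd rmorph_sign signr_odd.
    by congr (_ *+ _); apply: eq_card => s; rewrite !inE eq_sym.
  (* By definition, the parity of a permutation is that of n minus its number of cycles. *)
  by rewrite -(signr_odd _ (n - _)) oddB // -[in odd n](card_ord n).
rewrite (exchange_big_dep xpredT) //=; apply: eq_bigr => s _.
rewrite big_nat1_eq ltnS porbits_le andbT ifT //.
(* As n > 0, every permutation has a cycle, so starting the sum at [j = 1] loses nothing. *)
by apply/card_gt0P; exists (porbit s (Ordinal n_gt0)); apply: imset_f.
Qed.

(** * Powers of a class function with a given set of integer values *)

Section PowersOfClassFunction.

Variables (gT : finGroupType) (G : {group gT}) (phi : 'CF(G)) (vals : seq int).
Hypothesis vals_uniq : uniq vals.
Hypothesis vals0 : 0 \in vals.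
Hypothesis phi_vals : forall g, g \in G -> exists2 v, v \in vals & phi g = v%:~R.
Hypothesis vals_phi : forall v, v \in vals -> exists2 g, g \in G & phi g = v%:~R.

Let Q : {poly int} := \prod_(v <- vals) ('X - v%:P).
Let n := size vals.
Let ev (p : {poly int}) : 'CF(G) := horner_alg phi (map_poly intr p).

Lemma horner_alg_cfunE (p : {poly algC}) g :
  g \in G -> horner_alg phi p g = p.[phi g].
Proof.
move=> Gg; elim/poly_ind: p => [|p c IHp]; first by rewrite rmorph0 cfunE horner0.
rewrite rmorphD rmorphM /= horner_algX horner_algC.
by rewrite !cfunE IHp cfun1E Gg mulr1 !hornerE.
Qed.

(** Class functions multiply pointwise, and [phi] attains exactly the values in [vals]. *)
Lemma horner_alg_cfun_eq0 (p : {poly algC}) :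
  (horner_alg phi p == 0) = all (root p) (map intr vals).
Proof.
rewrite all_map; apply/eqP/allP => [p0 v /vals_phi[g Gg phig] | p0] /=.
  by rewrite /root -phig -horner_alg_cfunE // p0 cfunE.
apply/cfunP=> g; case: (boolP (g \in G)) => [Gg | G'g]; last by rewrite !cfun0.
have [v /p0/= /eqP pv phig] := phi_vals Gg.
by rewrite horner_alg_cfunE // phig pv cfunE.
Qed.

Lemma ev_eq0 p : (ev p == 0) = all (root p) vals.
Proof.
rewrite /ev horner_alg_cfun_eq0 all_map; apply: eq_all => v /=.
by rewrite /root horner_map /= intr_eq0.
Qed.

Lemma ev_sum (c : nat -> int) m :
  ev (\sum_(1 <= k < m) c k *: 'X^k) = \sum_(1 <= k < m) phi ^+ k *~ c k.
Proof.
rewrite /ev !rmorph_sum /=; apply: eq_bigr => k _.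
by rewrite map_polyZ map_polyXn linearZ /= rmorphXn /= horner_algX scaler_int mulrzl.
Qed.

Lemma evB p q : ev (p - q) = ev p - ev q.
Proof. by rewrite /ev !rmorphB. Qed.

Lemma evXn k : ev 'X^k = phi ^+ k.
Proof. by rewrite /ev map_polyXn rmorphXn /= horner_algX. Qed.

Lemma power_integral k : (0 < k)%N ->
  exists z : nat -> int, phi ^+ k = \sum_(1 <= j < n) phi ^+ j *~ z j.
Proof.
move=> k_gt0; have monQ : Q \is monic by apply: monic_prod_XsubC.
(* [Q] is monic, so division with remainder stays within integer polynomials; the coefficients are
   those of the remainder. *)
pose r := Pdiv.Ring.rmodp 'X^k Q; exists (fun j => r`_j).
have Xk := Pdiv.RingMonic.rdivp_eq monQ 'X^k.
have size_r : (size r <= n)%N.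
  have := Pdiv.Ring.ltn_rmodpN0 'X^k (monic_neq0 monQ).
  by rewrite size_prod_XsubC ltnS.
have evQ : ev Q = 0.
  by apply/eqP; rewrite ev_eq0; apply/allP=> v; rewrite /Q root_prod_XsubC.
(* Both ['X^k] and [Q] vanish at 0, hence so does the remainder, and no constant term appears. *)
have r0 : r`_0 = 0.
  have /(congr1 (horner^~ 0)) := Xk.
  have /eqP Q0 : root Q 0 by rewrite root_prod_XsubC.
  rewrite hornerXn expr0n gtn_eqF //= hornerD hornerM Q0 mulr0 add0r.
  by rewrite horner_coef0 => <-.
have n_gt0 : (0 < n)%N by rewrite /n; case: (vals) vals0.
rewrite -ev_sum -evXn Xk /ev !rmorphD !rmorphM /= -[X in _ * X + _]/(ev Q) evQ.
rewrite mulr0 add0r; congr (horner_alg phi (map_poly _ _)).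
have rE : r = \sum_(0 <= i < n) r`_i *: 'X^i.
  rewrite big_mkord -poly_def; apply/polyP=> i; rewrite coef_poly.
  by case: ltnP => // /(leq_trans size_r)/(nth_default 0)->.
by rewrite -/r [LHS]rE [LHS]big_ltn // r0 scale0r add0r.
Qed.

(** A linear relation yields a polynomial of degree less than [n] with [n] distinct roots. *)
Lemma powers_free : free [seq phi ^+ k | k <- iota 1 n.-1].
Proof.
rewrite -[map _ _]/(val [tuple of map (fun k => phi ^+ k) (iota_tuple n.-1 1)]).
apply/freeP=> c sum0.
pose p : {poly algC} := \sum_(i < n.-1) c i *: 'X^(i.+1).
have p0 : p = 0.
  apply: (roots_geq_poly_eq0 (rs := map intr vals)).
  - rewrite -horner_alg_cfun_eq0 -sum0 rmorph_sum /=; apply/eqP/eq_bigr => i _.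
    rewrite linearZ /= rmorphXn /= horner_algX (nth_map 0%N) ?size_iota //.
    by rewrite nth_iota ?add1n ?mulr_algl.
  - by rewrite map_inj_uniq //; apply: intr_inj.
  rewrite size_map; apply: (leq_trans (size_sum _ _ _)); apply/bigmax_leqP => i _.
  apply: leq_trans (size_scale_leq _ _) _; rewrite size_polyXn.
  by have := ltn_ord i; rewrite ltn_predRL.
move=> i; have := congr1 (coefp i.+1) p0; rewrite /= coef0 coef_sum => <-.
rewrite (bigD1 i) //= coefZ coefXn eqxx mulr1 big1 ?addr0 // => j ne_ji.
by rewrite coefZ coefXn eqSS eq_sym (inj_eq val_inj) (negPf ne_ji) mulr0.
Qed.

Lemma power_relation_poly (a : nat -> int) :
    phi ^+ n = \sum_(1 <= k < n) phi ^+ k *~ a k ->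
  'X^n - \sum_(1 <= k < n) a k *: 'X^k = Q.
Proof.
move=> rel; set P := _ - _; apply/eqP; rewrite -subr_eq0; apply/eqP.
have size_S : (size (\sum_(1 <= k < n) a k *: 'X^k : {poly int})%R <= n)%N.
  apply: (leq_trans (size_sum _ _ _)); rewrite big_nat.
  apply/bigmax_leqP_seq => i _ /andP[_ lt_in].
  by apply: leq_trans (size_scale_leq _ _) _; rewrite size_polyXn.
apply: (roots_geq_poly_eq0 (rs := vals)) => //.
  have evQ : ev Q = 0.
    by apply/eqP; rewrite ev_eq0; apply/allP=> v; rewrite /Q root_prod_XsubC.
  by rewrite -ev_eq0 !evB evQ evXn ev_sum rel subrr subr0.
(* Both polynomials are monic of degree [n]; pairing ['X^n] with [Q] cancels the leading terms, so
   [P - Q] has more roots than its degree allows unless it is 0. *)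
have -> : P - Q = ('X^n - Q) - \sum_(1 <= k < n) a k *: 'X^k.
  by rewrite /P addrAC.
apply: leq_trans (size_polyD _ _) _; rewrite size_polyN geq_max size_S andbT.
apply/leq_sizeP=> j; rewrite leq_eqVlt coefB coefXn => /orP[/eqP <- | lt_nj].
  have /monicP := monic_prod_XsubC vals xpredT id.
  by rewrite lead_coefE size_prod_XsubC eqxx /= => ->; rewrite subrr.
by rewrite gtn_eqF // nth_default ?subr0 // size_prod_XsubC.
Qed.

End PowersOfClassFunction.

(** * The values of the character of the Specht module *)

(* The numbers of fixed points of permutations of n >= 2 points. *)
Definition hook_fixed_counts (n : nat) : seq nat := n :: iota 0 n.-1.

Definition hook_values (n : nat) : seq int :=
  [seq k%:Z - 1 | k <- hook_fixed_counts n].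

Lemma mem_hook_fixed_counts n k :
  (k \in hook_fixed_counts n) = (k == n) || (k < n.-1)%N.
Proof. by rewrite inE mem_iota add0n. Qed.

Lemma hook_values_uniq n : uniq (hook_values n).
Proof.
rewrite map_inj_uniq => [|i j /addIr[]//].
by rewrite /= iota_uniq andbT mem_iota add0n -leqNgt leq_pred.
Qed.

Lemma size_hook_values n : (0 < n)%N -> size (hook_values n) = n.
Proof. by rewrite size_map /= size_iota => /prednK. Qed.

Lemma card_fixed_hook n (s : 'S_n) :
  #|[set i | s i == i]| \in hook_fixed_counts n.
Proof.
rewrite mem_hook_fixed_counts.
have [neq | ->] := card_fixed_neq_pred s.
  have := max_card [set i | s i == i]; rewrite card_ord in neq *.
  rewrite leq_eqVlt => /orP[-> // | lt_n]; apply/orP; right.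
  by rewrite ltn_neqAle neq -ltnS (ltn_predK lt_n).
apply/orP; left; rewrite -[X in _ == X]card_ord -cardsT; apply/eqP.
by congr #|pred_of_set _|; apply/setP=> i; rewrite !inE perm1 eqxx.
Qed.

Lemma card_fixed_hook_attained n k : (2 <= n)%N ->
  k \in hook_fixed_counts n -> exists s : 'S_n, #|[set i | s i == i]| = k.
Proof.
move=> n_ge2; rewrite mem_hook_fixed_counts => kP.
have le_kn : (k <= n)%N.
  by case/orP: kP => [/eqP-> // | /ltnW/leq_trans->//]; apply: leq_pred.
pose A : {set 'I_n} := [set i : 'I_n | (i < k)%N].
have cardA : #|A| = k.
  rewrite -sum1dep_card -(big_ord_widen _ (fun=> 1%N) le_kn).
  by rewrite sum1_card card_ord.
(* The complement of [A] has n - k points, which is not 1 because k is either n or less than n-1. *)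
have [|s fixs] := @perm_with_fixed_set _ A; last by exists s; rewrite fixs.
rewrite cardsCs setCK cardA card_ord.
case/orP: kP => [/eqP-> | ]; first by rewrite subnn.
by rewrite ltn_predRL -addn1 -ltn_subRL => /gtn_eqF->.
Qed.

(** The n subtracted ones cancel the entry n, leaving 0 + ... + (n-2). *)
Lemma sum_hook_values n :
  (2 <= n)%N -> \sum_(v <- hook_values n) v = 'C(n.-1, 2)%:Z.
Proof.
case: n => // n _; rewrite big_map sumrB big_const_seq count_predT /=.
rewrite size_iota big_cons iter_addr_0 -bin2_sum /index_iota subn0.
rewrite (big_morph Posz PoszD (erefl _)) -(natz n.+1) mulrS.
by rewrite addrAC subrr add0r.
Qed.

(** The hook values are -1, 0, ..., n-3 and n-1: compared with 0, ..., n-1, they lack n-2 and have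
    -1 in excess. *)
Lemma prod_hook_values n : (3 <= n)%N ->
  ('X - (n%:Z - 2)%:P) * \prod_(v <- hook_values n) ('X - v%:P) =
  ('X + 1) * \prod_(i < n) ('X - (i%:Z)%:P) :> {poly int}.
Proof.
case: n => [|[|m]] // _.
rewrite big_map big_cons /= big_cons !big_ord_recr /= (iotaDl 1 0) big_map.
rewrite -(big_mkord xpredT (fun i => 'X - (i%:Z)%:P)) /index_iota subn0.
have -> : m.+2%:Z - 2 = m%:Z by rewrite -addn2 PoszD addrK.
have -> : m.+2%:Z - 1 = m.+1%:Z by rewrite -addn1 PoszD addrK.
rewrite sub0r polyCN opprK polyC1.
rewrite [in LHS](eq_bigr (fun j : nat => 'X - (j%:Z)%:P)) => [|j _]; last first.
  by rewrite PoszD addrAC subrr add0r.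
by rewrite -!mulrA mulrA [LHS]mulrC -!mulrA.
Qed.

Theorem theorem46 (n : nat) (hn : (3 <= n)%N) :
  (exists V : {vspace 'CF([set: 'S_n])},
      is_positive_span (std_tensor_char n) V /\
      is_integral_basis (std_tensor_char n) n.-1 V) /\
  (exists a : nat -> int,
      std_tensor_char n n = \sum_(1 <= k < n) std_tensor_char n k *~ a k) /\
  (forall a : nat -> int,
      std_tensor_char n n = \sum_(1 <= k < n) std_tensor_char n k *~ a k ->
      a n.-1 = 'C(n.-1, 2)%:Z /\
      let P : {poly int} := 'X^n - \sum_(1 <= k < n) a k *: 'X^k in
      tofrac P =
        tofrac ('X + 1) / tofrac ('X - (n%:Z - 2)%:P) *
        tofrac (\sum_(1 <= j < n.+1)
                  ((cycle_count n j)%:Z * (-1) ^+ (n - j)) *: 'X^j)).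
Proof.
pose phi : 'CF([set: 'S_n]) := cfRepr (specht n [:: n.-1; 1%N]).
have n_gt0 : (0 < n)%N by apply: leq_trans hn.
have defF k : std_tensor_char n k = phi ^+ k := std_tensor_charE n k.
have phiE (g : 'S_n) : phi g = (#|[set i | g i == i]|%:Z - 1)%:~R.
  rewrite /phi rmorphB /= -pmulrn.
  by move: (n) hn (g) => [|[|m]] // _ h; apply: cfRepr_specht_hook.
have vals0 : 0 \in hook_values n.
  (* One fixed point gives the value 0, and 1 < n-1 as n is at least 3. *)
  apply/mapP; exists 1%N => //.
  by rewrite mem_hook_fixed_counts orbC -ltnS (ltn_predK hn) hn.
have phi_vals (g : 'S_n) : g \in [set: 'S_n] ->
    exists2 v, v \in hook_values n & phi g = v%:~R.
  by move=> _; rewrite phiE; eexists; first exact/map_f/card_fixed_hook.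
have vals_phi v : v \in hook_values n ->
    exists2 g : 'S_n, g \in [set: 'S_n] & phi g = v%:~R.
  case/mapP=> k /(card_fixed_hook_attained (ltnW hn))[g <-] ->.
  by exists g; rewrite ?inE.
have integral k : (0 < k)%N -> exists z : nat -> int,
    phi ^+ k = \sum_(1 <= j < n) phi ^+ j *~ z j.
  have := power_integral vals0 phi_vals vals_phi (k := k).
  by rewrite size_hook_values.
have std_sum (m : nat) (z : nat -> int) :
    \sum_(1 <= k < m) std_tensor_char n k *~ z k =
    \sum_(1 <= k < m) phi ^+ k *~ z k.
  by apply: eq_bigr => k _; rewrite defF.
split; [|split] => [||a].
- pose X := [tuple of map (std_tensor_char n) (iota_tuple n.-1 1)].
  have memF k : (0 < k)%N -> std_tensor_char n k \in <<X>>%VS.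
    case/integral=> z; rewrite defF => ->; rewrite big_nat.
    apply: memv_suml => j /andP[j_gt0 lt_jn]; rewrite -scaler_int memvZ //.
    rewrite -defF memv_span // map_f // mem_iota j_gt0 add1n.
    by rewrite (ltn_predK hn).
  exists <<X>>%VS; split=> [v|]; last split.
  + split=> [/coord_span-> | [m [c ->]]]; last first.
      rewrite big_nat; apply: memv_suml => k /andP[k_gt0 _].
      by rewrite memvZ ?memF.
    (* The coordinates in [X] are indexed from 0 and the powers from 1, hence [k.-1]; 0 is the
       default outside the range. *)
    exists n.-1, (fun k => if insub k.-1 is Some i then coord X i v else 0).
    rewrite big_add1 big_mkord; apply: eq_bigr => i _ /=.
    by rewrite valK (nth_map 0%N) ?size_iota // nth_iota ?add1n.
  + rewrite /basis_of eqxx /=.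
    have := powers_free (hook_values_uniq n) phi_vals vals_phi.
    by rewrite size_hook_values // (eq_map defF).
  move=> k /integral[z phik]; exists z.
  by rewrite (ltn_predK hn) std_sum defF.
- by have [z phin] := integral n n_gt0; exists z; rewrite std_sum defF.
rewrite std_sum defF => rel.
have relP := power_relation_poly (hook_values_uniq n) phi_vals vals_phi (a := a).
rewrite size_hook_values // in relP; have {relP rel}defP := relP rel.
split.
  (* The coefficient of degree n-1 in [Q] is minus the sum of its roots. *)
  have := @coefPn_prod_XsubC _ (hook_values n).
  rewrite size_hook_values // -defP sum_hook_values ?(ltnW hn) // -lt0n => /(_ n_gt0).
  rewrite coefB coefXn ltn_eqF ?ltn_predL // sub0r => /oppr_inj <-.
  rewrite coef_sum -{2}(prednK n_gt0) big_nat_recr /=; last first.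
    by rewrite -ltnS (ltn_predK hn) ltnW.
  rewrite coefZ coefXn eqxx mulr1 big_nat big1 ?add0r // => k /andP[_ lt_k].
  by rewrite coefZ coefXn gtn_eqF ?mulr0.
set D := 'X - _.
(* Multiplying by [D] turns the identity of fractions into that of [prod_hook_values]. *)
have D_neq0 : tofrac D != 0 by rewrite tofrac_eq0 polyXsubC_eq0.
move=> P; apply: (mulfI D_neq0); rewrite /P defP sum_cycle_count // -tofracM.
by rewrite prod_hook_values // tofracM [RHS]mulrA [tofrac D * _]mulrC divfK.
Qed.
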